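(* Let $r \ge 3$ be an integer. Then there exists $m_0$ such that for every integer $m \ge m_0$, at least one of the pairs $\left(m, \left\lfloor \binom{m}{r}/2 \right\rfloor\right)$ and $\left(m, \left\lfloor \binom{m}{r}/2 \right\rfloor - m - 1\right)$ is absolutely $r$-avoidable.
   Context: An $r$-graph is an $r$-uniform hypergraph. For an $r$-graph $G$ and a pair of non-negative integers $(m,f)$, write $G \to_r (m,f)$ if $G$ has an induced sub-hypergraph on $m$ vertices with exactly $f$ hyperedges. For pairs of non-negative integers, write $(n,e) \to_r (m,f)$ if every $r$-graph with $n$ vertices and $e$ hyperedges satisfies $G \to_r (m,f)$. A pair $(m,f)$ with $m \ge 1$ and $0 \le f \le \binom{m}{r}$ is called absolutely $r$-avoidable if there is $n_0$ such that for every $n > n_0$ and every integer $e$ with $0 \le e \le \binom{n}{r}$, we have $(n,e) \not\to_r (m,f)$, i.e. there exists an $r$-graph on $n$ vertices with $e$ hyperedges having no induced sub-hypergraph on $m$ vertices with $f$ hyperedges. *)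

(* Defs.v *)
From mathcomp Require Import all_boot.

Set Implicit Arguments.
Unset Strict Implicit.
Unset Printing Implicit Defensive.

(* A hypergraph on the vertex set T is given by its set of hyperedges. *)
Definition is_rgraph (r : nat) (T : finType) (G : {set {set T}}) : Prop :=
  forall h : {set T}, h \in G -> #|h| = r.

Definition induced (T : finType) (G : {set {set T}}) (U : {set T}) :
    {set {set T}} :=
  [set h in G | h \subset U].

Definition graph_arrow (T : finType) (G : {set {set T}}) (m f : nat) : Prop :=
  exists U : {set T}, #|U| = m /\ #|induced G U| = f.

(* Up to isomorphism, the r-graphs with n vertices are those on 'I_n. *)
Definition pair_arrow (r n e m f : nat) : Prop :=
  forall G : {set {set 'I_n}},
    is_rgraph r G -> #|G| = e -> graph_arrow G m f.

Definition absolutely_avoidable (r m f : nat) : Prop :=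
  [/\ 1 <= m, f <= 'C(m, r)
    & exists n0 : nat, forall n : nat, n0 < n ->
        forall e : nat, e <= 'C(n, r) -> ~ pair_arrow r n e m f].

(* Main.v *)
Require Import Defs.
From mathcomp Require Import all_boot.
From mathcomp Require Import zify.

(** A disjoint union of a clique on k vertices, 'C(k, r) <= e < 'C(k.+1, r), and
    a hypergraph in which every m vertices span at most m hyperedges realizes
    every e <= 'C(n, r) / 2: then n - k is linear in n, at most
    'C(k, r - 1) = O(n ^ (r - 1)) sparse hyperedges are needed, and a random
    choice with density about L / n, followed by a deletion step, supplies
    C n ^ (r - 1) of them with C as large as we like.  Larger e are realized by
    complements.  Hence (m, f) is avoidable unless f or 'C(m, r) - f lies in
    ['C(x, r), 'C(x, r) + m] for some x.  Near 'C(m, r) / 2 the gaps between the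
    values 'C(x, r) are of order m ^ (r - 1), which exceeds 3m + 3 as r >= 3, so
    a single x would have to obstruct both pairs, and the shift by m + 1
    excludes this. *)

(** * Random colorings and deletion *)

Lemma card_colorings_const0 (X : finType) (q : nat) (F : {set X}) :
  #|[set c : {ffun X -> 'I_q.+1} | F \subset [set x | c x == ord0]]|
    * q.+1 ^ #|F| = q.+1 ^ #|X|.
Proof.
pose D (x : X) : {pred 'I_q.+1} := [pred j | (x \in F) ==> (j == ord0)].
have -> : #|[set c : {ffun X -> 'I_q.+1} | F \subset [set x | c x == ord0]]|
        = #|family D|.
  apply: eq_card => c; rewrite inE; apply/subsetP/familyP => [h x | h x xF].
    by rewrite inE; apply/implyP => /h; rewrite inE.
  by have := h x; rewrite !inE xF.
rewrite card_family foldrE big_map big_enum /=.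
rewrite (bigID (mem F)) /= big1 ?mul1n => [|x xF]; last first.
  by rewrite -(card1 (@ord0 q)); apply: eq_card => j; rewrite !inE xF.
rewrite (eq_bigr (fun=> q.+1)) => [|x xF]; last first.
  rewrite -[RHS]card_ord; apply: eq_card => j.
  by rewrite !inE (negbTE xF).
rewrite prod_nat_const -expnD -(cardC (mem F)) addnC; congr (_ ^ (_ + _)).
Qed.

Lemma sum_card_exchange (C T : finType) (A : {set T}) (R : C -> T -> bool) :
  \sum_(c : C) #|[set x in A | R c x]| = \sum_(x in A) #|[set c | R c x]|.
Proof.
under eq_bigr do rewrite -sum1_card.
under [RHS]eq_bigr do rewrite -sum1_card.
rewrite (exchange_big_dep (mem A)) /= => [|c x _]; last by rewrite inE => /andP[].
by apply: eq_bigr => x xA; apply: eq_bigl => c; rewrite !inE xA.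
Qed.

(* Averaging over uniformly random q-colorings: the color class of 0 keeps each
   point with probability 1/q and each F in P with probability 1/q^(s+1); one
   point of every surviving F is then deleted. *)
Lemma exists_large_independent_set (X : finType) (Y : {set X})
    (P : {set {set X}}) (s q : nat) :
    0 < q -> (forall F, F \in P -> #|F| = s.+1) ->
  exists I : {set X}, [/\ I \subset Y, (forall F, F \in P -> ~~ (F \subset I))
    & q ^ s * #|Y| <= q ^ s.+1 * #|I| + #|P|].
Proof.
case: q => // q _ cardP.
pose zero (c : {ffun X -> 'I_q.+1}) := [set x | c x == ord0].
pose Z (c : {ffun X -> 'I_q.+1}) := [set x in Y | c x == ord0].
pose b c := [set F in P | F \subset zero c].
have sumZ : (\sum_c #|Z c|) * q.+1 = #|Y| * q.+1 ^ #|X|.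
  rewrite /Z sum_card_exchange big_distrl -sum_nat_const /=.
  apply: eq_bigr => x _; rewrite -(card_colorings_const0 _ q [set x]) cards1 expn1.
  by congr (_ * _); apply: eq_card => c; rewrite !inE sub1set inE.
have sumb : (\sum_c #|b c|) * q.+1 ^ s.+1 = #|P| * q.+1 ^ #|X|.
  rewrite /b sum_card_exchange big_distrl -sum_nat_const /=.
  apply: eq_bigr => F FP.
  by rewrite -(card_colorings_const0 _ q F) (cardP _ FP).
have [c hc] : exists c, q.+1 ^ s * #|Y| + q.+1 ^ s.+1 * #|b c|
                     <= q.+1 ^ s.+1 * #|Z c| + #|P|.
  (* Summed over all colorings, both sides agree exactly by [sumZ] and [sumb], so strict failure at
     every [c] is impossible. *)
  apply/existsP; apply: contraT; rewrite negb_exists => /forallP hlt.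
  have hle (c : {ffun X -> 'I_q.+1}) : true ->
      (q.+1 ^ s.+1 * #|Z c| + #|P|).+1 <= q.+1 ^ s * #|Y| + q.+1 ^ s.+1 * #|b c|.
    by move=> _; rewrite ltnNge hlt.
  have := leq_sum (index_enum _) hle.
  under eq_bigr do rewrite -addn1.
  rewrite !big_split /= -!big_distrr /= !sum_nat_const card_ffun card_ord.
  rewrite [_ * \sum_c #|b c|]mulnC sumb expnSr -mulnA [q.+1 * _]mulnC sumZ muln1.
  by rewrite [#|Y| * _]mulnC [#|P| * _]mulnC -[X in _ <= X]addn0 leq_add2l leqn0
    expn_eq0.
have nonempty F : F \in b c -> exists x, x \in F.
  by rewrite inE => /andP[/cardP cF _]; apply/card_gt0P; rewrite cF.
pose rep (F : {set X}) := [pick x in F].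
pose W := [set x | Some x \in [set rep F | F in b c]].
have cardW : #|W| <= #|b c|.
  apply: leq_trans (leq_imset_card rep _).
  rewrite -(card_imset (mem W) (@Some_inj _)); apply: subset_leq_card.
  by apply/subsetP => _ /imsetP[x xW ->]; move: xW; rewrite inE.
exists (Z c :\: W); split.
- by apply/subsetP => x; rewrite !inE => /and3P[].
- move=> F FP; apply/negP => /subsetP FI.
  have Fb : F \in b c.
    rewrite inE FP; apply/subsetP => x /FI.
    by rewrite !inE => /and3P[].
  have [x0 x0F] := nonempty F Fb.
  have [x repF xF] : exists2 x, rep F = Some x & x \in F.
    by rewrite /rep; case: pickP => [x xF | /(_ x0)]; [exists x | rewrite x0F].
  have := FI x xF; rewrite inE => /andP[/negP[]].
  by rewrite inE -repF imset_f.
- have hZ : #|Z c| <= #|Z c :\: W| + #|b c|.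
    rewrite -(cardsID W (Z c)) addnC leq_add2l.
    by apply: leq_trans cardW; apply/subset_leq_card/subsetIr.
  rewrite -(leq_add2r (q.+1 ^ s.+1 * #|b c|)); apply: leq_trans hc _.
  by rewrite addnAC leq_add2r -mulnDr leq_mul2l hZ orbT.
Qed.

(** * Locally sparse hypergraphs *)

Lemma exists_subset_of_card {T : finType} {A : {set T}} {k : nat} :
  k <= #|A| -> exists2 B : {set T}, B \subset A & #|B| = k.
Proof.
rewrite -bin_gt0 -cards_draws => /card_gt0P[B].
by rewrite inE => /andP[BA /eqP cB]; exists B.
Qed.

Definition complete_rgraph {T : finType} (r : nat) (A : {set T}) : {set {set T}} :=
  [set h : {set T} | h \subset A & #|h| == r].

(** The points are now the hyperedges, and the forbidden configurations are the sets of [m.+1]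
    hyperedges inside one [m]-set; the last product bounds their number. *)
Lemma exists_locally_sparse {T : finType} (B : {set T}) (r m q : nat) :
    0 < q ->
  exists H : {set {set T}}, [/\ H \subset complete_rgraph r B,
    (forall U : {set T}, #|U| = m -> #|induced H U| <= m)
    & q ^ m * 'C(#|B|, r)
        <= q ^ m.+1 * #|H| + 'C(#|T|, m) * 'C('C(m, r), m.+1)].
Proof.
move=> q_gt0.
pose K (U : {set T}) := complete_rgraph r U.
pose P := \bigcup_(U in [set U : {set T} | U \subset [set: T] & #|U| == m])
  [set F : {set {set T}} | F \subset K U & #|F| == m.+1].
have cardP F : F \in P -> #|F| = m.+1.
  by case/bigcupP => U _; rewrite inE => /andP[_ /eqP].
have leP : #|P| <= 'C(#|T|, m) * 'C('C(m, r), m.+1).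
  rewrite -cardsT -cards_draws -sum_nat_const /P.
  apply: (@leq_trans (\sum_(U in [set U : {set T} | U \subset [set: T] & #|U| == m])
    #|[set F : {set {set T}} | F \subset K U & #|F| == m.+1]|)).
    elim/big_rec2: _ => [|U n A _ IH]; first by rewrite cards0.
    by apply: leq_trans (leq_card_setU _ _).1 _; rewrite leq_add2l.
  apply: leq_sum => U; rewrite inE => /andP[_ /eqP cU].
  by rewrite cards_draws cards_draws cU.
have [H [HK Hind Hcard]] := @exists_large_independent_set _ (K B) P m q q_gt0 cardP.
exists H; split=> // [U cU|].
  rewrite leqNgt; apply/negP => /exists_subset_of_card[F FH cF].
  have /negP[] : ~~ (F \subset H).
    apply: Hind; apply/bigcupP; exists U; first by rewrite inE subsetT cU /=.
    rewrite inE cF eqxx andbT; apply: subset_trans FH _.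
    apply/subsetP => h; rewrite !inE => /andP[/(subsetP HK)].
    by rewrite inE => /andP[_ ->] ->.
  by apply: subset_trans FH _; apply/subsetP => h; rewrite inE => /andP[].
by move: Hcard; rewrite cards_draws => /leq_trans -> //; rewrite leq_add2l.
Qed.

(** * Binomial estimates and density *)

Lemma leq_exp2rW {m n : nat} (e : nat) : m <= n -> m ^ e <= n ^ e.
Proof. by case: e => // e; rewrite leq_exp2r. Qed.

Lemma bin_le_exp (n k : nat) : 'C(n, k) <= n ^ k.
Proof.
apply: leq_trans (leq_pmulr _ (fact_gt0 k)) _; rewrite bin_ffact.
elim: k => [|k IH]; first by rewrite ffactn0.
by rewrite ffactnSr expnSr leq_mul // leq_subr.
Qed.

(** Every factor of the falling factorial is at least [n / 2]. *)
Lemma exp_le_bin {n k : nat} : 2 * k <= n -> n ^ k <= k`! * 2 ^ k * 'C(n, k).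
Proof.
move=> kn; rewrite -mulnA mulnC -mulnA bin_ffact.
suff H j : j <= k -> n ^ j <= 2 ^ j * n ^_ j by apply: H.
elim: j => [|j IH] jk; first by rewrite ffactn0.
rewrite !expnSr ffactnSr mulnACA; apply: leq_mul; first by apply/IH/ltnW.
by lia.
Qed.

Lemma bin_subr_le (n k r : nat) : k <= n ->
  'C(n, r.+1) <= 'C(k, r.+1) + (n - k) * 'C(n, r).
Proof.
elim: n => [|n IH]; first by rewrite leqn0 => /eqP->; rewrite leq_addr.
rewrite leq_eqVlt => /predU1P[-> | kn]; first by rewrite leq_addr.
rewrite binS subSn // mulSn addnCA [X in X <= _]addnC leq_add ?leq_bin2l //.
apply: leq_trans (IH kn) _; rewrite leq_add2l leq_mul2l leq_bin2l ?orbT //.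
Qed.

(** Let n be [#|T|]. With [q] about [n / L], the forbidden configurations cost only the constant [K]
    after division by [q ^ m], while [E] satisfies n^(r+1) <= E * 'C(#|B|, r+1). Taking [L = 2 * E]
    leaves a factor 2 to absorb [K]. *)
Lemma exists_dense_locally_sparse (r m D : nat) : 0 < D ->
  exists n0 : nat, forall (T : finType) (B : {set T}),
    n0 < #|T| -> #|T| <= D * #|B| ->
    exists H : {set {set T}}, [/\ H \subset complete_rgraph r.+1 B,
      (forall U : {set T}, #|U| = m -> #|induced H U| <= m)
      & #|T| ^ r <= #|H|].
Proof.
move=> D_gt0.
pose E := D ^ r.+1 * ((r.+1)`! * 2 ^ r.+1); pose L := 2 * E.
pose K := (2 * L) ^ m * 'C('C(m, r.+1), m.+1).
have L_gt0 : 0 < L by rewrite !muln_gt0 fact_gt0 !expn_gt0 D_gt0.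
(* The summands ensure, in turn, [2 * r.+1 <= #|B|], [0 < q], and the final contradiction with
   n^(r+1) <= L * K. *)
exists (2 * r.+1 * D + L + L * K) => T B; set n := #|T| => n_large nB.
pose q := n %/ L.
have q_gt0 : 0 < q by rewrite divn_gt0 //; lia.
have qL : q * L <= n by rewrite leq_divM.
have nq : n <= 2 * L * q.
  have := ltn_ceil n L_gt0; rewrite -/q => h.
  by apply: leq_trans (ltnW h) _; rewrite mulnC -mulnA mulnCA leq_mul2l; lia.
have [H [HB Hloc Hcard]] := exists_locally_sparse B r.+1 m q q_gt0.
exists H; split=> //; rewrite -/n leqNgt; apply/negP => H_small.
have B_large : 2 * r.+1 <= #|B|.
  by rewrite -(leq_pmul2l D_gt0) mulnC; apply: leq_trans nB; lia.
have hbin : 'C(#|B|, r.+1) <= q * #|H| + K.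
  have qm_gt0 : 0 < q ^ m by rewrite expn_gt0 q_gt0.
  rewrite -(leq_pmul2l qm_gt0); apply: leq_trans Hcard _.
  rewrite mulnDr expnSr mulnA leq_add2l /K mulnA -expnMn [q * _]mulnC.
  rewrite leq_mul2r; apply/orP; right; apply: leq_trans (bin_le_exp _ _) _.
  exact: leq_exp2rW.
have hn : n ^ r.+1 <= E * 'C(#|B|, r.+1).
  rewrite /E -mulnA; apply: leq_trans (leq_mul (leqnn _) (exp_le_bin B_large)).
  by rewrite -expnMn leq_exp2r.
have h1 : 2 * n ^ r.+1 <= L * (q * n ^ r + K).
  rewrite /L -mulnA leq_mul2l /=; apply: leq_trans hn _.
  rewrite leq_mul2l; apply/orP; right; apply: leq_trans hbin _.
  by rewrite leq_add2r leq_mul2l ltnW ?orbT.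
have h2 : L * q * n ^ r <= n ^ r.+1.
  by rewrite expnS leq_mul2r mulnC qL orbT.
have h3 : n <= n ^ r.+1.
  by rewrite expnS leq_pmulr // expn_gt0; lia.
move: h1; rewrite mulnDr mulnA; lia.
Qed.

(** * Clique plus sparse hypergraph *)

(** The [n - k] outside vertices must account for half of all hyperedges, at most ['C(n, r)] each,
    and 'C(n, r+1) is (n - r) / (r + 1) times ['C(n, r)]. *)
Lemma clique_complement_large (r n k : nat) :
  2 * r < n -> k <= n -> 2 * 'C(k, r.+1) <= 'C(n, r.+1) -> n <= 4 * r.+1 * (n - k).
Proof.
move=> rn kn half.
have h1 := bin_subr_le n k r kn.
have h2 := mul_bin_left n r.
have b_gt0 : 0 < 'C(n, r) by rewrite bin_gt0; lia.
suff : n - r <= 2 * r.+1 * (n - k) by lia.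
rewrite -(leq_pmul2r b_gt0) -h2 mulnAC -mulnA mulnAC mulnA.
have : 'C(n, r.+1) <= 2 * ((n - k) * 'C(n, r)) by lia.
nia.
Qed.

Lemma exists_clique_plus_sparse (r m : nat) :
  exists n0 : nat, forall n e : nat, n0 < n -> 2 * e <= 'C(n, r.+1) ->
    exists G : {set {set 'I_n}}, [/\ is_rgraph r.+1 G, #|G| = e
      & forall U : {set 'I_n}, #|U| = m ->
        exists x y, [/\ x <= m, y <= m & #|induced G U| = 'C(x, r.+1) + y]].
Proof.
have [n0 sparse] := @exists_dense_locally_sparse r m (4 * r.+1) isT.
exists (n0 + 2 * r.+1) => n e n_large half.
have C_gt0 : 0 < 'C(n, r.+1) by rewrite bin_gt0; lia.
pose P k := (k <= n) && ('C(k, r.+1) <= e).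
have exP : exists k, P k by exists 0; rewrite /P bin0n.
have ubP k : P k -> k <= n by case/andP.
case: (ex_maxnP exP ubP) => k /andP[kn ke] kmax.
(* Maximality of [k] gives this by Pascal's rule; [k = n] is excluded because [e] is at most half of
   a positive number. *)
have eS : e < 'C(k, r.+1) + 'C(k, r).
  rewrite -binS ltnNge; apply/negP => h.
  have [kltn|] := ltnP k n; first by have := kmax k.+1; rewrite /P kltn h ltnn => /(_ isT).
  move=> nk; have : k = n by lia.
  by move=> kE; move: ke; rewrite kE; lia.
have [A _ cA] : exists2 A : {set 'I_n}, A \subset [set: 'I_n] & #|A| = k.
  by apply: exists_subset_of_card; rewrite cardsT card_ord.
have cB : #|~: A| = n - k by rewrite cardsCs setCK card_ord cA.
have [] := sparse 'I_n (~: A); rewrite ?card_ord ?cB; first by lia.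
  by apply: clique_complement_large; lia.
move=> S [SB Sloc Scard].
have [H HS cH] : exists2 H : {set {set 'I_n}}, H \subset S & #|H| = e - 'C(k, r.+1).
  apply: exists_subset_of_card; apply: leq_trans Scard.
  apply: (@leq_trans 'C(k, r)); first by lia.
  by apply: leq_trans (bin_le_exp _ _) _; apply: leq_exp2rW.
have inH h : h \in H -> h \subset ~: A /\ #|h| = r.+1.
  by move/(subsetP HS)/(subsetP SB); rewrite inE => /andP[-> /eqP].
(* A common hyperedge would lie in [A] and in its complement, yet hyperedges have [r.+1 > 0]
   vertices. *)
have dis (U : {set 'I_n}) : complete_rgraph r.+1 (A :&: U) :&: induced H U = set0.
  apply/eqP; rewrite -subset0; apply/subsetP => h; rewrite !inE subsetI.
  case/andP => /andP[/andP[hA _] /eqP ch] /andP[/inH[hB _] _].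
  have : h \subset A :&: ~: A by rewrite subsetI hA.
  by rewrite setICr subset0 -cards_eq0 ch.
have cardK (X : {set 'I_n}) : #|complete_rgraph r.+1 X| = 'C(#|X|, r.+1).
  by rewrite cards_draws.
have indE (U : {set 'I_n}) : induced (complete_rgraph r.+1 A :|: H) U
    = complete_rgraph r.+1 (A :&: U) :|: induced H U.
  by apply/setP => h; rewrite !inE subsetI andb_orl -!andbA; congr (_ && _ || _); rewrite andbC.
have cardU (U : {set 'I_n}) : #|induced (complete_rgraph r.+1 A :|: H) U|
    = 'C(#|A :&: U|, r.+1) + #|induced H U|.
  by rewrite indE cardsU dis cards0 subn0 cardK.
have indT (F : {set {set 'I_n}}) : induced F setT = F.
  by apply/setP => h; rewrite inE subsetT andbT.
exists (complete_rgraph r.+1 A :|: H); split.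
- by move=> h; rewrite !inE => /orP[/andP[_ /eqP] // | /inH[]].
- by rewrite -(indT (_ :|: H)) cardU setIT indT cA cH; lia.
- move=> U cU; exists #|A :&: U|, #|induced H U|; split=> //.
    by rewrite -cU subset_leq_card // subsetIr.
  apply: leq_trans (Sloc U cU); apply/subset_leq_card/subsetP => h.
  by rewrite !inE => /andP[/(subsetP HS) -> ->].
Qed.

(* Edge counts that m vertices may span in a clique plus a sparse hypergraph;
   boolean so that the proof of the theorem can branch on it. *)
Definition clique_plus_sparse (r m f : nat) : bool :=
  [exists x : 'I_m.+1, exists y : 'I_m.+1, f == 'C(x, r) + y].

Lemma clique_plus_sparseP (r m f : nat) :
  reflect (exists x y, [/\ x <= m, y <= m & f = 'C(x, r) + y])
    (clique_plus_sparse r m f).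
Proof.
apply: (iffP existsP) => [[x /existsP[y /eqP->]] | [x [y [xm ym ->]]]].
  by exists x, y; rewrite -ltnS ltn_ord -ltnS ltn_ord.
by exists (inord x); apply/existsP; exists (inord y); rewrite !inordK.
Qed.

(** * Complements and the avoidability criterion *)

Lemma induced_complement {n r : nat} {G : {set {set 'I_n}}} (U : {set 'I_n}) :
  is_rgraph r G ->
  #|induced (complete_rgraph r setT :\: G) U| + #|induced G U| = 'C(#|U|, r).
Proof.
move=> rG; rewrite -cards_draws.
rewrite -(cardsID G [set h : {set 'I_n} | h \subset U & #|h| == r]) addnC.
congr (_ + _); apply: eq_card => h; rewrite !inE.
  case hG: (h \in G); last by rewrite andbF.
  by rewrite (rG h hG) eqxx !andbT.
by rewrite subsetT -andbA; congr (_ && _); rewrite andbC.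
Qed.

Lemma avoidable_of_not_clique_plus_sparse (r m f : nat) :
    0 < r -> 0 < m -> f <= 'C(m, r) ->
    ~~ clique_plus_sparse r m f -> ~~ clique_plus_sparse r m ('C(m, r) - f) ->
  absolutely_avoidable r m f.
Proof.
case: r => // r _ m_gt0 f_le /negP Nf /negP Ncf; split=> //.
have [n0 con] := exists_clique_plus_sparse r m.
exists n0 => n n_large e e_le arrow.
have [half | half] := leqP (2 * e) 'C(n, r.+1).
  have [G [rG cG ind]] := con n e n_large half.
  by have [U [/ind cU fU]] := arrow G rG cG; case: Nf; rewrite -fU; apply/clique_plus_sparseP.
have [|G [rG cG ind]] := con n ('C(n, r.+1) - e) n_large; first by lia.
pose G' := complete_rgraph r.+1 setT :\: G.
have indT (F : {set {set 'I_n}}) : induced F setT = F.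
  by apply/setP => h; rewrite inE subsetT andbT.
have rG' : is_rgraph r.+1 G' by move=> h; rewrite !inE => /and3P[_ _ /eqP].
have cG' : #|G'| = e.
  have := induced_complement setT rG; rewrite !indT -/G' cG cardsT card_ord; lia.
have [U [cU fU]] := arrow G' rG' cG'.
case: Ncf; have := induced_complement U rG; rewrite -/G' fU cU => <-.
by rewrite addKn; apply/clique_plus_sparseP/ind.
Qed.

(** * Gaps near the half and conclusion *)

(** The gap is at least ['C(x, r - 1)]. If that were at most [3 * m + 3], then ['C(x, r)], hence
    ['C(m, r)], would be O(m^2), against its growth of order at least m^3. *)
Lemma bin_gap_near_half (r m x x' : nat) :
    3 <= r -> r`! * 2 ^ r * 40 <= m -> x < x' -> x <= m ->
    'C(m, r) <= 2 * 'C(x, r) + 4 * m + 4 ->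
  'C(x, r) + 3 * m + 3 < 'C(x', r).
Proof.
case: r => // r r3 m_large xx' xm near_half.
have /(leq_trans _) : 'C(x.+1, r.+1) <= 'C(x', r.+1) by apply: leq_bin2l.
apply; rewrite binS -addnA ltn_add2l.
rewrite ltnNge; apply/negP => small.
pose c := (r.+1)`! * 2 ^ r.+1.
have c_gt0 : 0 < c by rewrite muln_gt0 fact_gt0 expn_gt0.
have rc : 2 * r.+1 <= c.
  by rewrite mulnC /c expnS leq_mul ?factS ?leq_pmulr ?expn_gt0 ?fact_gt0.
have m3 : m ^ 3 <= c * 'C(m, r.+1).
  apply: (@leq_trans (m ^ r.+1)); first by apply: leq_pexp2l; lia.
  by apply: exp_le_bin; lia.
have bx : 'C(x, r.+1) * 3 <= m * (3 * (m + 1)).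
  apply: (@leq_trans ('C(x, r) * (x - r))).
    by rewrite [X in _ <= X]mulnC -mul_bin_left mulnC leq_mul2r r3 orbT.
  by rewrite mulnC leq_mul //; lia.
have bm : 'C(m, r.+1) <= 2 * (m * (m + 1)) + 4 * m + 4 by lia.
have : m ^ 3 <= c * (2 * (m * (m + 1)) + 4 * m + 4).
  by apply: leq_trans m3 _; rewrite leq_mul2l bm orbT.
have -> : m ^ 3 = m * (m * m) by rewrite !expnS expn0 muln1.
have : c * 40 <= m by [].
(* Half of the 40 in the hypothesis, so m^3 <= 20 c m^2 contradicts 40 c m^2 <= m^3. *)
have : 2 * (m * (m + 1)) + 4 * m + 4 <= 20 * (m * m) by nia.
move=> h1 h2 h3.
have h4 : c * (2 * (m * (m + 1)) + 4 * m + 4) <= c * (20 * (m * m)) by rewrite leq_mul2l h1 orbT.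
have h5 : c * 40 * (m * m) <= m * (m * m) by rewrite leq_mul2r h2 orbT.
have : 0 < c * (m * m) by nia.
lia.
Qed.

Theorem theorem1p3 (r : nat) (hr : 3 <= r) :
  exists m0 : nat, forall m : nat, m0 <= m ->
    absolutely_avoidable r m ('C(m, r) %/ 2) \/
    (m + 1 <= 'C(m, r) %/ 2 /\
     absolutely_avoidable r m ('C(m, r) %/ 2 - m - 1)).
Proof.
exists (r`! * 2 ^ r * 40) => m m_large.
have m_gt0 : 0 < m.
  by apply: leq_trans m_large; rewrite !muln_gt0 fact_gt0 expn_gt0.
have gap := bin_gap_near_half r m _ _ hr m_large.
(* Either [N] exceeds [4 * m + 4], or the gap between ['C(0, r) = 0] and ['C(m, r)] applies. This
   keeps [f - m - 1] from truncating. *)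
have N_large : 2 * m + 2 <= 'C(m, r).
  have := gap 0 m m_gt0 isT; rewrite bin0n gtn_eqF /=; last by lia.
  by case: (leqP 'C(m, r) (4 * m + 4)) => [_ /(_ isT) | ]; lia.
set N := 'C(m, r) in gap N_large *; set f := N %/ 2.
have [avoid_f | ] := boolP (~~ clique_plus_sparse r m f
                           && ~~ clique_plus_sparse r m (N - f)).
  left; case/andP: avoid_f; apply: avoidable_of_not_clique_plus_sparse => //; lia.
rewrite negb_and !negbK => hit_f; right; split; first by lia.
(* Since [f <= N - f <= f + 1], both ways of hitting [f] give the same window. *)
have [x [xm xlo xhi]] : exists x, [/\ x <= m, f <= 'C(x, r) + m & 'C(x, r) <= N - f].
  by case/orP: hit_f => /clique_plus_sparseP[x [y [xm ym fE]]]; exists x; split=> //; lia.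
(* The window has length at most [3 * m + 3] and contains ['C(x, r)], so the gap bound allows no
   second value. *)
have separated x' : x' <= m -> f <= 'C(x', r) + 2 * m + 1 ->
    'C(x', r) <= N - f + m + 1 -> 'C(x', r) = 'C(x, r).
  move=> x'm x'lo x'hi; case: (ltngtP x x') => [lt | lt | -> //].
    have := gap x x' lt xm; lia.
  have := gap x' x lt x'm; lia.
(* A hit would reuse ['C(x, r)], but [f - m - 1] lies below it and [N - f + m + 1] lies above
   ['C(x, r) + m]. *)
apply: avoidable_of_not_clique_plus_sparse => //; rewrite -/N; try lia.
  apply/clique_plus_sparseP => -[x' [y [x'm ym fE]]].
  have := separated x' x'm; lia.
apply/clique_plus_sparseP => -[x' [y [x'm ym fE]]].
have := separated x' x'm; lia.
Qed.
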